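(* Let $T_0$ be any initial BST. For every $\epsilon>0$ there exists a query sequence $X$ such that $$\mathrm{cost}(GF,\mathrm{rev}(X),T_0)\ge(2-\epsilon)\cdot\mathrm{cost}(GF,X,T_0),$$ where $\mathrm{rev}(X)$ denotes the sequence $X$ in reverse order.
   Context: Binary search tree model. Keys are $\{1,\dots,n\}$. A query sequence is $X=[x_1,\dots,x_m]\in[n]^m$ and $T_0$ is an initial binary search tree (BST) on the keys. An algorithm $A$ serves $x_1,\dots,x_m$ in order. Before serving $x_t$ it holds a BST $T_{t-1}$; it searches $x_t$ from the root and may then restructure the tree by rotations into $T_t$. Let $P_t$ be the set of nodes on the root-to-$x_t$ path of $T_{t-1}$, and let $U_t$ be the node set of the minimal subtree containing all edges rotated in transforming $T_{t-1}$ into $T_t$. The cost at time $t$ is $|P_t\cup U_t|$, and $\mathrm{cost}(A,X,T_0)$ is the sum of these costs over $t=1,\dots,m$. Greedy Future ($GF$). After finding $x_t$ in $T_{t-1}$, let $v_1<\dots<v_k$ be the keys on the root-to-$x_t$ path, set $v_0=-\infty$ and $v_{k+1}=+\infty$, and let $R_0,\dots,R_k$ be the subtrees hanging off this path. For each $i$, $\tau(v_i)$ is the smallest $s>t$ with $x_s\in(v_{i-1},v_{i+1})$, or $+\infty$ if there is none. $GF$ rearranges $v_1,\dots,v_k$ as a treap: a BST in key order and a heap in $\tau$, with the smallest $\tau$ at the top. Ties in $\tau$ are broken in favor of the node of smaller depth in $T_{t-1}$. It then reattaches $R_0,\dots,R_k$ unchanged at their unique positions, giving $T_t$.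
   Formalization: The query sequence X is required to be nonempty, and the initial BST must have at least N keys, where N depends only on epsilon; for n = 1 every sequence and its reverse have equal cost, so the claim fails for a nonempty X and epsilon < 1. *)

(* Defs.v *)
From mathcomp Require Import all_boot.
From Stdlib Require Import Reals.

Set Implicit Arguments.
Unset Strict Implicit.
Unset Printing Implicit Defensive.

Inductive tree : Type :=
| Leaf : tree
| Node : tree -> nat -> tree -> tree.

Fixpoint inorder (T : tree) : seq nat :=
  match T with
  | Leaf => [::]
  | Node l k r => inorder l ++ k :: inorder r
  end.

(* T is a binary search tree on the keys {1,...,n}: its in-order traversal
   is exactly 1, 2, ..., n (this gives both the BST property and the key set). *)
Definition is_bst_on (n : nat) (T : tree) : Prop := inorder T = iota 1 n.

Definition query_seq_on (n : nat) (X : seq nat) : Prop :=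
  all (fun x => (1 <= x <= n)%N) X.

(* Search for x starting at depth d.  Returns
   - the keys on the root-to-x path, paired with their depth, sorted by key
     (v_1 < ... < v_k), and
   - the subtrees hanging off the path, in key order (R_0, ..., R_k). *)
Fixpoint path_split (x : nat) (T : tree) (d : nat)
  : seq (nat * nat) * seq tree :=
  match T with
  | Leaf => ([::], [:: Leaf])
  | Node l k r =>
      if x == k then ([:: (k, d)], [:: l; r])
      else if (x < k)%N then
        let: (ks, rs) := path_split x l d.+1 in (rcons ks (k, d), rcons rs r)
      else
        let: (ks, rs) := path_split x r d.+1 in ((k, d) :: ks, l :: rs)
  end.

Definition search_cost (x : nat) (T : tree) : nat := size (path_split x T 0).1.

Definition in_window (ks : seq nat) (i : nat) (y : nat) : bool :=
  (if i is i'.+1 then (nth 0 ks i' < y)%N else true) &&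
  (if (i.+1 < size ks)%N then (y < nth 0 ks i.+1)%N else true).

(* tau(v_i), measured relative to the current time t: the offset in the
   future sequence x_{t+1}, x_{t+2}, ... of the first query in the window,
   or size future (larger than every real offset) when there is none,
   which plays the role of +oo. *)
Definition tau (future : seq nat) (ks : seq nat) (i : nat) : nat :=
  find (in_window ks i) future.

(* priorities: lexicographic (tau, depth); smaller is higher in the treap.
   Depths on a path are distinct, so this is a strict total order there. *)
Definition plt (p q : nat * nat) : bool :=
  (p.1 < q.1)%N || ((p.1 == q.1) && (p.2 < q.2)%N).

Definition pmin (p q : nat * nat) : nat * nat := if plt q p then q else p.

(* items: (key, (tau, depth)) sorted by key; subs: hanging subtrees (one more
   than items).  Builds the treap on the items with the subtrees reattached. *)
Fixpoint build_treap (fuel : nat) (items : seq (nat * (nat * nat)))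
  (subs : seq tree) : tree :=
  match fuel, items with
  | 0, _ => head Leaf subs
  | _, [::] => head Leaf subs
  | f.+1, it0 :: _ =>
      let mp := foldr pmin it0.2 (map snd items) in
      let i := find (fun it => it.2 == mp) items in
      Node (build_treap f (take i items) (take i.+1 subs))
           (nth it0 items i).1
           (build_treap f (drop i.+1 items) (drop i.+1 subs))
  end.

Definition gf_step (future : seq nat) (T : tree) (x : nat) : tree :=
  let: (kd, subs) := path_split x T 0 in
  let ks := map fst kd in
  let items := [seq (nth 0 ks i, (tau future ks i, nth 0 (map snd kd) i))
               | i <- iota 0 (size kd)] in
  build_treap (size items) items subs.

(* cost(GF, X, T0): sum over t of |P_t| (GF only rotates edges
   inside the search path, so |P_t u U_t| = |P_t|). *)
Fixpoint gf_cost (T : tree) (X : seq nat) : nat :=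
  match X with
  | [::] => 0
  | x :: rest => search_cost x T + gf_cost (gf_step rest T x) rest
  end.

(* Main.v *)
Require Import Defs.
From mathcomp Require Import all_boot zify.
From Stdlib Require Import Reals Lra.

Set Implicit Arguments.
Unset Strict Implicit.
Unset Printing Implicit Defensive.

(* Split the keys 1, ..., 5L into L cells of five consecutive keys
   a_j < r_j < b_j < s_j < t_j, and let the word w sweep down over
   b_{L-1}, ..., b_0 and then up over a_0, ..., a_{L-1}.  Repeating w forever,
   GF can be in two regimes, depending on the tree it starts from.  In the good
   regime the b_j form a path and each a_j hangs below it; an access to b_j
   costs 2 and an access to a_j costs 3, so a period costs 5L - 2.  In the bad
   regime the keys r_j, s_j, t_j, which are never queried, form the upper part
   of the tree and all queried keys are leaves; for the reversed word (down over
   the a_j, up over the b_j) every access away from the ends costs 5, so a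
   period costs 10L - 6.  Each regime reproduces itself after one period, and a
   prefix in which keys are accessed twice in a row can force either regime from
   an arbitrary initial tree.  Hence
   X = (good prefix) w^M (reverse of bad prefix) works for M, L large. *)

(** * Search paths and in-order traversal *)

Fixpoint merge_trees (ks : seq nat) (rs : seq tree) : seq nat :=
  if rs is r :: rs' then
    inorder r ++ (if ks is k :: ks' then k :: merge_trees ks' rs' else [::])
  else [::].

Lemma merge_trees_cat k ks1 ks2 rs1 rs2 : size rs1 = (size ks1).+1 ->
  merge_trees (ks1 ++ k :: ks2) (rs1 ++ rs2) =
  merge_trees ks1 rs1 ++ k :: merge_trees ks2 rs2.
Proof.
elim: ks1 rs1 => [|k1 ks1 IH] [|r1 rs1] //= [].
  by case: rs1 => //= _; rewrite cats0.
by move=> sz; rewrite IH // -catA.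
Qed.

Lemma subseq_merge_trees ks rs : size rs = (size ks).+1 ->
  subseq ks (merge_trees ks rs).
Proof.
elim: ks rs => [|k ks IH] [|r rs] //= [sz]; first exact: sub0seq.
by rewrite -[k :: ks]cat0s cat_subseq ?sub0seq //= eqxx IH.
Qed.

Lemma path_split_eq x l r d : path_split x (Node l x r) d = ([:: (x, d)], [:: l; r]).
Proof. by rewrite /= eqxx. Qed.

Lemma path_split_lt x k l r d : x < k ->
  path_split x (Node l k r) d =
  (rcons (path_split x l d.+1).1 (k, d), rcons (path_split x l d.+1).2 r).
Proof. by move=> lt_xk; rewrite /= ltn_eqF // lt_xk; case: path_split. Qed.

Lemma path_split_gt x k l r d : k < x ->
  path_split x (Node l k r) d =
  ((k, d) :: (path_split x r d.+1).1, l :: (path_split x r d.+1).2).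
Proof.
move=> lt_kx; rewrite /= gtn_eqF // ltnNge (ltnW lt_kx) /=.
by case: path_split.
Qed.

Lemma size_path_split x T d :
  size (path_split x T d).2 = (size (path_split x T d).1).+1.
Proof.
elim: T d => [|l IHl k r IHr] d //.
have [lt|gt|<-] := ltngtP x k; last by rewrite path_split_eq.
  by rewrite path_split_lt //= !size_rcons IHl.
by rewrite path_split_gt //= IHr.
Qed.

Lemma merge_path_split x T d :
  merge_trees (map fst (path_split x T d).1) (path_split x T d).2 = inorder T.
Proof.
elim: T d => [|l IHl k r IHr] d //.
have [lt|gt|<-] := ltngtP x k; last by rewrite path_split_eq /= cats0.
  rewrite path_split_lt //= map_rcons -!cats1 merge_trees_cat /=.
    by rewrite IHl cats0.
  by rewrite size_path_split size_map.
by rewrite path_split_gt //= IHr.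
Qed.

Lemma subseq_path_split x T d :
  subseq (map fst (path_split x T d).1) (inorder T).
Proof.
rewrite -(merge_path_split x T d); apply: subseq_merge_trees.
by rewrite size_path_split size_map.
Qed.

Lemma sorted_node l k r : sorted ltn (l ++ k :: r) ->
  [/\ sorted ltn l, sorted ltn r, {in l, forall y, y < k} &
      {in r, forall y, k < y}].
Proof.
rewrite !(sorted_pairwise ltn_trans) pairwise_cat /= => /and3P[].
rewrite allrel_consr => /andP[/allP ltl _] sl /andP[/allP ltr sr].
by split.
Qed.

Lemma mem_path_split x T d : sorted ltn (inorder T) -> x \in inorder T ->
  x \in map fst (path_split x T d).1.
Proof.
elim: T d => [|l IHl k r IHr] d //= /sorted_node[sl sr ltl ltr].
rewrite mem_cat inE => xT.
have [lt|gt|->] := ltngtP x k; last by rewrite inE.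
  have xl : x \in inorder l.
    by case/or3P: xT => // [/eqP e|/ltr]; lia.
  have := IHl d.+1 sl xl; case: path_split => a b /= xa.
  by rewrite map_rcons mem_rcons inE xa orbT.
have xr : x \in inorder r.
  by case/or3P: xT => // [/ltl|/eqP e]; lia.
have := IHr d.+1 sr xr; case: path_split => a b /= xa.
by rewrite inE xa orbT.
Qed.

(** * Treaps built from strictly ordered priorities *)

Lemma pltxx p : plt p p = false.
Proof. by rewrite /plt !ltnn andbF. Qed.

Lemma plt_asym p q : plt p q -> plt q p = false.
Proof. rewrite /plt; lia. Qed.

Lemma foldr_pmin_mem z s : foldr pmin z s \in z :: s.
Proof.
elim: s => [|u s IH] /=; first by rewrite inE.
rewrite {1}/pmin; case: ifP => _; last by rewrite !inE eqxx orbT.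
by move: IH; rewrite !inE => /orP[] ->; rewrite ?orbT.
Qed.

Lemma foldr_pmin m z s : m \in z :: s ->
  {in z :: s, forall q, q != m -> plt m q} -> foldr pmin z s = m.
Proof.
elim: s => [|p s IH] /=; first by rewrite inE => /eqP.
move=> ms lt.
have ltp : p != m -> plt m p by apply: lt; rewrite !inE eqxx orbT.
have [ms'|nms'] := boolP (m \in z :: s).
  rewrite IH // => [|q qs]; last first.
    by apply: lt; move: qs; rewrite !inE => /orP[] ->; rewrite ?orbT.
  rewrite /pmin; have [->|/ltp ->] := eqVneq p m; by rewrite ?pltxx.
have pm : p = m.
  move: ms nms'; rewrite !inE; case: (m == z) => //=.
  by case/orP=> [/eqP->|->].
rewrite pm /pmin; suff -> : plt (foldr pmin z s) m = false by [].
have fs := foldr_pmin_mem z s; apply: plt_asym; apply: lt.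
  by move: fs; rewrite !inE => /orP[] ->; rewrite ?orbT.
by apply: contra nms' => /eqP <-.
Qed.

(** The strict minimum is attained only at [p], so [find] stops exactly at index [size I1], and the
    subtrees are cut just after [S1]. *)
Lemma build_treap_top f (I1 I2 : seq (nat * (nat * nat))) S1 S2 p :
  size S1 = (size I1).+1 ->
  {in I1 ++ I2, forall q, plt p.2 q.2} ->
  build_treap f.+1 (I1 ++ p :: I2) (S1 ++ S2) =
  Node (build_treap f I1 S1) p.1 (build_treap f I2 S2).
Proof.
move=> sz lt.
have lt' q : q \in I1 ++ p :: I2 -> q.2 != p.2 -> plt p.2 q.2.
  rewrite mem_cat inE orbCA -mem_cat => /orP[/eqP->|/lt //].
  by rewrite eqxx.
have [it0 [s es]] : exists it0 s, I1 ++ p :: I2 = it0 :: s.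
  by case: (I1) => [|u v]; do 2 eexists.
have mpE : foldr pmin it0.2 (map snd (it0 :: s)) = p.2.
  apply: foldr_pmin.
    rewrite inE; apply/orP; right; apply: map_f.
    by rewrite -es mem_cat inE eqxx orbT.
  have mapP' q : q \in map snd (I1 ++ p :: I2) -> q != p.2 -> plt p.2 q.
    by case/mapP=> u uin ->; exact: lt'.
  move=> q; rewrite inE => /orP[/eqP->|]; last by rewrite -es; exact: mapP'.
  by apply: lt'; rewrite es inE eqxx.
have iE : find (fun it : nat * (nat * nat) => it.2 == p.2) (it0 :: s) = size I1.
  rewrite -es find_cat /= eqxx addn0 ifF //.
  apply/negbTE/hasPn => q qin; apply/negP => /eqP e.
  by have := lt q; rewrite mem_cat qin e pltxx => /(_ isT).
have unf it s' subs : build_treap f.+1 (it :: s') subs =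
  let mp := foldr pmin it.2 (map snd (it :: s')) in
  let i := find (fun q : nat * (nat * nat) => q.2 == mp) (it :: s') in
  Node (build_treap f (take i (it :: s')) (take i.+1 subs))
       (nth it (it :: s') i).1
       (build_treap f (drop i.+1 (it :: s')) (drop i.+1 subs)) by [].
rewrite [in LHS]es unf; cbv zeta; rewrite mpE iE.
rewrite -es take_size_cat // nth_cat ltnn subnn -[nth _ (p :: I2) 0]/p.
have -> : drop (size I1).+1 (I1 ++ p :: I2) = I2.
  by rewrite -cat_rcons drop_size_cat // size_rcons.
by rewrite -sz take_size_cat // drop_size_cat.
Qed.

(** Whichever item becomes the root, the items before it keep exactly one more subtree than their
    number, so [merge_trees_cat] glues the two halves back in key order. *)
Lemma inorder_build_treap f I S : size I <= f -> size S = (size I).+1 ->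
  inorder (build_treap f I S) = merge_trees (map fst I) S.
Proof.
elim: f I S => [|f IH] [|p I] // [|r S] //.
- by case: S => //= _ _; rewrite cats0.
- by case: S => //= _ _; rewrite cats0.
move=> le_If [szS].
pose it := p :: I; pose mp := foldr pmin p.2 (map snd it).
pose i := find (fun q : nat * (nat * nat) => q.2 == mp) it.
have lt_i : i < size it.
  rewrite -has_find; have [q qin e] : exists2 q, q \in it & q.2 = mp.
    rewrite /mp; suff : foldr pmin p.2 (map snd it) \in map snd it.
      by case/mapP=> q qin ->; exists q.
    have := foldr_pmin_mem p.2 (map snd it).
    by rewrite inE => /orP[/eqP->|//]; exact: mem_head.
  by apply/hasP; exists q; rewrite // e.
have -> : build_treap f.+1 (p :: I) (r :: S) =
  Node (build_treap f (take i it) (take i.+1 (r :: S))) (nth p it i).1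
       (build_treap f (drop i.+1 it) (drop i.+1 (r :: S))) by [].
have szit : size it <= f.+1 by [].
have szrS : size (r :: S) = (size it).+1 by rewrite /= szS.
have e1 : size (take i.+1 (r :: S)) = (size (take i it)).+1.
  by rewrite !size_take szrS ltnS lt_i.
rewrite -[LHS]/(inorder _ ++ _ :: inorder _).
rewrite !IH ?size_take ?size_drop ?szrS ?lt_i //.
- rewrite -merge_trees_cat ?size_map //.
  by rewrite cat_take_drop -map_cons -map_cat -drop_nth // cat_take_drop.
- lia.
- lia.
- by rewrite -ltnS (leq_trans lt_i).
- by rewrite ltnS lt_i.
Qed.

(** * GF steps preserve the in-order sequence *)

Definition items_of (F : seq nat) (kd : seq (nat * nat)) : seq (nat * (nat * nat)) :=
  [seq (nth 0 (map fst kd) i, (tau F (map fst kd) i, nth 0 (map snd kd) i))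
  | i <- iota 0 (size kd)].

Lemma size_items_of F kd : size (items_of F kd) = size kd.
Proof. by rewrite size_map size_iota. Qed.

Lemma map_fst_items_of F kd : map fst (items_of F kd) = map fst kd.
Proof.
rewrite -map_comp -[RHS](mkseq_nth 0) /mkseq size_map.
by apply: eq_map.
Qed.

Lemma gf_stepE F T x : gf_step F T x =
  build_treap (size (path_split x T 0).1) (items_of F (path_split x T 0).1)
    (path_split x T 0).2.
Proof. by rewrite /gf_step -(size_items_of F); case: path_split. Qed.

Lemma inorder_gf_step F T x : inorder (gf_step F T x) = inorder T.
Proof.
rewrite gf_stepE inorder_build_treap ?size_items_of //.
  by rewrite map_fst_items_of merge_path_split.
exact: size_path_split.
Qed.

Lemma search_cost_le x T : search_cost x T <= size (inorder T).
Proof.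
by rewrite /search_cost -(size_map fst) size_subseq // subseq_path_split.
Qed.

Lemma gf_cost_le T X : gf_cost T X <= size X * size (inorder T).
Proof.
elim: X T => [|x X IH] T //=; rewrite mulSn leq_add ?search_cost_le //.
by rewrite -(inorder_gf_step X T x).
Qed.

(** * Serving a segment of a longer query sequence *)

Inductive serves (F : seq nat) : tree -> seq nat -> tree -> nat -> Prop :=
| ServesNil T : serves F T [::] T 0
| ServesCons T x X T' c : serves F (gf_step (X ++ F) T x) X T' c ->
    serves F T (x :: X) T' (search_cost x T + c).

(** Every [tau] depends on all queries still to come, so a segment carries its continuation; while
    [X] is served, that continuation starts with [Y]. *)
Lemma serves_cat F T X Y T1 T2 c1 c2 : serves (Y ++ F) T X T1 c1 ->
  serves F T1 Y T2 c2 -> serves F T (X ++ Y) T2 (c1 + c2).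
Proof.
move=> s1 s2; elim: s1 s2 => {T X T1 c1} [T //|T x X T' c _ IH] /IH.
by rewrite -addnA catA => s; constructor.
Qed.

Lemma serves_cost F T X T' c : serves F T X T' c ->
  gf_cost T (X ++ F) = c + gf_cost T' F.
Proof. by elim=> {T X T' c} // T x X T' c _ /= ->; rewrite addnA. Qed.

Lemma serves_inorder F T X T' c : serves F T X T' c -> inorder T' = inorder T.
Proof. by elim=> {T X T' c} // T x X T' c _ ->; rewrite inorder_gf_step. Qed.

Lemma serves_cost_le F T X T' c : serves F T X T' c ->
  c <= size X * size (inorder T).
Proof.
elim=> {T X T' c} // T x X T' c _.
by rewrite inorder_gf_step mulSn => le_c; rewrite leq_add ?search_cost_le.
Qed.

(* The shape of the treap built by one GF step: inner nodes carry the rank of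
   the node among v_1 < ... < v_k, leaves carry the subtrees hanging off the
   path.  As sk_heap is strict, a heap-ordered skeleton determines the result. *)
Inductive skeleton :=
| SL of tree
| SN of skeleton & nat & skeleton.

Fixpoint sk_indices S :=
  if S is SN l i r then sk_indices l ++ i :: sk_indices r else [::].

Fixpoint sk_leaves S :=
  match S with
  | SL t => [:: t]
  | SN l i r => sk_leaves l ++ sk_leaves r
  end.

Fixpoint sk_tree (key : nat -> nat) S :=
  match S with
  | SL t => t
  | SN l i r => Node (sk_tree key l) (key i) (sk_tree key r)
  end.

Fixpoint sk_heap (pr : nat -> nat * nat) S :=
  if S is SN l i r then
    all (fun j => plt (pr i) (pr j)) (sk_indices l ++ sk_indices r) &&
    (sk_heap pr l && sk_heap pr r)
  else true.

Lemma build_treap_skeleton key pr f S : size (sk_indices S) <= f ->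
  sk_heap pr S ->
  build_treap f [seq (key i, pr i) | i <- sk_indices S] (sk_leaves S) =
  sk_tree key S.
Proof.
have szl : forall S', size (sk_leaves S') = (size (sk_indices S')).+1.
  by elim=> //= l IHl i r IHr; rewrite !size_cat /= IHl IHr; lia.
elim: S f => [t|l IHl i r IHr] [|f] //.
  by rewrite /= size_cat addnS.
rewrite [sk_indices _]/= [sk_leaves _]/= size_cat addnS ltnS => szf.
case/and3P=> /allP top hl hr; rewrite map_cat build_treap_top.
- by rewrite IHl ?IHr // (leq_trans _ szf) // ?leq_addl ?leq_addr.
- by rewrite szl size_map.
by move=> q; rewrite -map_cat => /mapP[j jin ->] /=; exact: top.
Qed.

Lemma gf_step_skeleton F T x kd S :
  path_split x T 0 = (kd, sk_leaves S) ->
  sk_indices S = iota 0 (size kd) ->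
  sk_heap (fun i => (tau F (map fst kd) i, nth 0 (map snd kd) i)) S ->
  gf_step F T x = sk_tree (nth 0 (map fst kd)) S.
Proof.
move=> eT eS hS; rewrite gf_stepE eT /= /items_of -eS.
by rewrite build_treap_skeleton // eS size_iota.
Qed.

(** * Comparing arrival times of queries in windows *)

Lemma tau_eq0 F h ks i : in_window ks i h -> tau (h :: F) ks i = 0.
Proof. by rewrite /tau /= => ->. Qed.

Lemma tau_all F0 F ks i : 0 < size F0 -> {in F0, forall q, in_window ks i q} ->
  tau (F0 ++ F) ks i = 0.
Proof. by case: F0 => // h F0 _ hF; rewrite tau_eq0 // hF ?mem_head. Qed.

Lemma tau_gt0 F h ks i : ~~ in_window ks i h -> 0 < tau (h :: F) ks i.
Proof. by rewrite /tau /= => /negbTE->. Qed.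

Lemma tau_eq F0 y F ks i : {in F0, forall q, ~~ in_window ks i q} ->
  in_window ks i y -> tau (F0 ++ y :: F) ks i = size F0.
Proof.
move=> /hasPn/negbTE h0 hy; rewrite /tau find_cat h0 /= hy addn0 //.
Qed.

Lemma tau_gt F0 y F ks i : {in F0, forall q, ~~ in_window ks i q} ->
  ~~ in_window ks i y -> size F0 < tau (F0 ++ y :: F) ks i.
Proof.
move=> /hasPn/negbTE h0 /negbTE hy; rewrite /tau find_cat h0 /= hy; lia.
Qed.

Lemma plt_lt t u d e : t < u -> plt (t, d) (u, e).
Proof. by rewrite /plt /= => ->. Qed.

(** * Single accesses *)

Definition step_to F T x T' c := gf_step F T x = T' /\ search_cost x T = c.

(** The arrival times enter through a variable [tv], so that the heap condition becomes linear
    arithmetic over atoms [tv i] bounded beforehand. *)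
Lemma step_to_skeleton F T x T' kd S :
  path_split x T 0 = (kd, sk_leaves S) ->
  sk_indices S = iota 0 (size kd) ->
  sk_tree (nth 0 (map fst kd)) S = T' ->
  (forall tv, tv =1 tau F (map fst kd) ->
    sk_heap (fun i => (tv i, nth 0 (map snd kd) i)) S) ->
  step_to F T x T' (size kd).
Proof.
move=> eT eS <- hS; split; first by apply: gf_step_skeleton (hS _ _).
by rewrite /search_cost eT.
Qed.

Lemma serves_step_to F T x X T1 T2 c1 c2 : step_to (X ++ F) T x T1 c1 ->
  serves F T1 X T2 c2 -> serves F T (x :: X) T2 (c1 + c2).
Proof. by case=> <- <-; exact: ServesCons. Qed.

Ltac split_path :=
  repeat first [ rewrite path_split_eq | rewrite path_split_lt; [|lia]
               | rewrite path_split_gt; [|lia] ]; reflexivity.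

Ltac window := rewrite /in_window /=; lia.

Ltac heap_order := rewrite /= /plt /=; lia.

Lemma step_root F Z x W : step_to F (Node Z x W) x (Node Z x W) 1.
Proof.
apply: (step_to_skeleton (kd := [:: (x, 0)]) (S := SN (SL Z) 0 (SL W))) => //.
by split_path.
Qed.

Lemma step_rotate_right F h Z x A z W : x < z -> h <= x ->
  step_to (h :: F) (Node (Node Z x A) z W) x (Node Z x (Node A z W)) 2.
Proof.
move=> xz hx.
apply: (step_to_skeleton (kd := [:: (x, 1); (z, 0)])
  (S := SN (SL Z) 0 (SN (SL A) 1 (SL W)))) => //; first by split_path.
move=> tv tvE.
have e0 : tv 0 = 0 by rewrite tvE; apply: tau_eq0; window.
have e1 : 0 < tv 1 by rewrite tvE; apply: tau_gt0; window.
heap_order.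
Qed.

Lemma step_rotate_left F h Z x A z W : x < z -> z <= h ->
  step_to (h :: F) (Node Z x (Node A z W)) z (Node (Node Z x A) z W) 2.
Proof.
move=> xz zh.
apply: (step_to_skeleton (kd := [:: (x, 0); (z, 1)])
  (S := SN (SN (SL Z) 0 (SL A)) 1 (SL W))) => //; first by split_path.
move=> tv tvE.
have e0 : 0 < tv 0 by rewrite tvE; apply: tau_gt0; window.
have e1 : tv 1 = 0 by rewrite tvE; apply: tau_eq0; window.
heap_order.
Qed.

Lemma step_good_first F h P y Q z W :
  y < z -> z <= h ->
  step_to (h :: F)
    (Node (Node P y Q) z W) y
    (Node (Node P y Q) z W) 2.
Proof.
move=> lt hP.
apply: (step_to_skeleton (kd := [:: (y, 1); (z, 0)])
  (S := SN (SN (SL P) 0 (SL Q)) 1 (SL W)))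
  => //; first by split_path.
move=> tv tvE.
have e0 : 0 < tv 0 by rewrite tvE; apply: tau_gt0; window.
have e1 : tv 1 = 0 by rewrite tvE; apply: tau_eq0; window.
heap_order.
Qed.

(** While [F0] lasts only the window of [z] is hit, which puts [z] on top; then [q0] hits the window
    of [x] but not that of [y], so [y] sinks below [x]. *)
Lemma step_good_up F0 F Z x P y Q z W q0 :
  x < y < z -> 0 < size F0 -> {in F0, forall q, z <= q} -> q0 <= x ->
  step_to (F0 ++ q0 :: F)
    (Node Z x (Node (Node P y Q) z W)) y
    (Node (Node Z x (Node P y Q)) z W) 3.
Proof.
move=> lt szF F0P q0P.
apply: (step_to_skeleton (kd := [:: (x, 0); (y, 2); (z, 1)])
  (S := SN (SN (SL Z) 0 (SN (SL P) 1 (SL Q))) 2 (SL W)))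
  => //; first by split_path.
move=> tv tvE.
have e0 : tv 0 = size F0 by rewrite tvE; apply: tau_eq => [q /F0P|]; window.
have e1 : size F0 < tv 1 by rewrite tvE; apply: tau_gt => [q /F0P|]; window.
have e2 : tv 2 = 0 by rewrite tvE; apply: tau_all => // q /F0P; window.
heap_order.
Qed.

Lemma step_bad_top F0 F Y t P a P' r Q q0 :
  t < a < r -> 0 < size F0 -> {in F0, forall q, q < t} -> r < q0 ->
  step_to (F0 ++ q0 :: F)
    (Node Y t (Node (Node P a P') r Q)) a
    (Node Y t (Node (Node P a P') r Q)) 3.
Proof.
move=> lt szF F0P q0P.
apply: (step_to_skeleton (kd := [:: (t, 0); (a, 2); (r, 1)])
  (S := SN (SL Y) 0 (SN (SN (SL P) 1 (SL P')) 2 (SL Q))))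
  => //; first by split_path.
move=> tv tvE.
have e0 : tv 0 = 0 by rewrite tvE; apply: tau_all => // q /F0P; window.
have e1 : size F0 < tv 1 by rewrite tvE; apply: tau_gt => [q /F0P|]; window.
have e2 : tv 2 = size F0 by rewrite tvE; apply: tau_eq => [q /F0P|]; window.
heap_order.
Qed.

(** The query [q0] falls between the adjacent path keys [r] and [s], so both get the same [tau]. The
    tie goes to the shallower [s], which keeps [r] below [s] and the queried [a] below [r]. *)
Lemma step_bad_down F0 F Y t P a P' r Q s X t' W q0 :
  [&& t < a, a < r, r < s & s < t'] -> 0 < size F0 ->
  {in F0, forall q, q < t} -> r < q0 < s ->
  step_to (F0 ++ q0 :: F)
    (Node (Node (Node Y t (Node (Node P a P') r Q)) s X) t' W) a
    (Node Y t (Node (Node (Node P a P') r Q) s (Node X t' W))) 5.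
Proof.
move=> lt szF F0P q0P.
apply: (step_to_skeleton (kd := [:: (t, 2); (a, 4); (r, 3); (s, 1); (t', 0)])
  (S := SN (SL Y) 0 (SN (SN (SN (SL P) 1 (SL P')) 2 (SL Q)) 3 (SN (SL X) 4 (SL W)))))
  => //; first by split_path.
move=> tv tvE.
have e0 : tv 0 = 0 by rewrite tvE; apply: tau_all => // q /F0P; window.
have e1 : size F0 < tv 1 by rewrite tvE; apply: tau_gt => [q /F0P|]; window.
have e2 : tv 2 = size F0 by rewrite tvE; apply: tau_eq => [q /F0P|]; window.
have e3 : tv 3 = size F0 by rewrite tvE; apply: tau_eq => [q /F0P|]; window.
have e4 : size F0 < tv 4 by rewrite tvE; apply: tau_gt => [q /F0P|]; window.
heap_order.
Qed.

Lemma step_bad_bottom F P a P' r Q s X t W q0 :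
  [&& a < r, r < s & s < t] -> r < q0 < s ->
  step_to (q0 :: F)
    (Node (Node (Node (Node P a P') r Q) s X) t W) a
    (Node (Node (Node P a P') r Q) s (Node X t W)) 4.
Proof.
move=> lt q0P.
apply: (step_to_skeleton (kd := [:: (a, 3); (r, 2); (s, 1); (t, 0)])
  (S := SN (SN (SN (SL P) 0 (SL P')) 1 (SL Q)) 2 (SN (SL X) 3 (SL W))))
  => //; first by split_path.
move=> tv tvE.
have e0 : 0 < tv 0 by rewrite tvE; apply: tau_gt0; window.
have e1 : tv 1 = 0 by rewrite tvE; apply: tau_eq0; window.
have e2 : tv 2 = 0 by rewrite tvE; apply: tau_eq0; window.
have e3 : 0 < tv 3 by rewrite tvE; apply: tau_gt0; window.
heap_order.
Qed.

Lemma step_bad_first F0 F P r Q b Q' s W q0 :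
  r < b < s -> 0 < size F0 -> {in F0, forall q, s < q} -> q0 < r ->
  step_to (F0 ++ q0 :: F)
    (Node (Node P r (Node Q b Q')) s W) b
    (Node (Node P r (Node Q b Q')) s W) 3.
Proof.
move=> lt szF F0P q0P.
apply: (step_to_skeleton (kd := [:: (r, 1); (b, 2); (s, 0)])
  (S := SN (SN (SL P) 0 (SN (SL Q) 1 (SL Q'))) 2 (SL W)))
  => //; first by split_path.
move=> tv tvE.
have e0 : tv 0 = size F0 by rewrite tvE; apply: tau_eq => [q /F0P|]; window.
have e1 : size F0 < tv 1 by rewrite tvE; apply: tau_gt => [q /F0P|]; window.
have e2 : tv 2 = 0 by rewrite tvE; apply: tau_all => // q /F0P; window.
heap_order.
Qed.

(** Mirror situation: [q0] lies between [t] and [r], and the tie is won by the shallower [t]. *)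
Lemma step_bad_up F0 F V s X t P r Q b Q' s' W q0 :
  [&& s < t, t < r, r < b & b < s'] -> 0 < size F0 ->
  {in F0, forall q, s' < q} -> t < q0 < r ->
  step_to (F0 ++ q0 :: F)
    (Node V s (Node X t (Node (Node P r (Node Q b Q')) s' W))) b
    (Node (Node (Node V s X) t (Node P r (Node Q b Q'))) s' W) 5.
Proof.
move=> lt szF F0P q0P.
apply: (step_to_skeleton (kd := [:: (s, 0); (t, 1); (r, 3); (b, 4); (s', 2)])
  (S := SN (SN (SN (SL V) 0 (SL X)) 1 (SN (SL P) 2 (SN (SL Q) 3 (SL Q')))) 4 (SL W)))
  => //; first by split_path.
move=> tv tvE.
have e0 : size F0 < tv 0 by rewrite tvE; apply: tau_gt => [q /F0P|]; window.
have e1 : tv 1 = size F0 by rewrite tvE; apply: tau_eq => [q /F0P|]; window.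
have e2 : tv 2 = size F0 by rewrite tvE; apply: tau_eq => [q /F0P|]; window.
have e3 : size F0 < tv 3 by rewrite tvE; apply: tau_gt => [q /F0P|]; window.
have e4 : tv 4 = 0 by rewrite tvE; apply: tau_all => // q /F0P; window.
heap_order.
Qed.

Lemma step_bad_last F V s X t P r Q b Q' q0 :
  [&& s < t, t < r & r < b] -> t < q0 < r ->
  step_to (q0 :: F)
    (Node V s (Node X t (Node P r (Node Q b Q')))) b
    (Node (Node V s X) t (Node P r (Node Q b Q'))) 4.
Proof.
move=> lt q0P.
apply: (step_to_skeleton (kd := [:: (s, 0); (t, 1); (r, 2); (b, 3)])
  (S := SN (SN (SL V) 0 (SL X)) 1 (SN (SL P) 2 (SN (SL Q) 3 (SL Q')))))
  => //; first by split_path.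
move=> tv tvE.
have e0 : 0 < tv 0 by rewrite tvE; apply: tau_gt0; window.
have e1 : tv 1 = 0 by rewrite tvE; apply: tau_eq0; window.
have e2 : tv 2 = 0 by rewrite tvE; apply: tau_eq0; window.
have e3 : 0 < tv 3 by rewrite tvE; apply: tau_gt0; window.
heap_order.
Qed.

(** The next two queries fix the order [x], then [z], and neither lies in the window of [y]; the
    left chain becomes a zigzag with [y] lowest. *)
Lemma step_unnest F Z x C y C' z D :
  x < y < z ->
  step_to (x :: z :: F)
    (Node (Node (Node Z x C) y C') z D) x
    (Node Z x (Node (Node C y C') z D)) 3.
Proof.
move=> lt.
apply: (step_to_skeleton (kd := [:: (x, 2); (y, 1); (z, 0)])
  (S := SN (SL Z) 0 (SN (SN (SL C) 1 (SL C')) 2 (SL D))))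
  => //; first by split_path.
move=> tv tvE.
have e0 : tv 0 = 0 by rewrite tvE; apply: tau_eq0; window.
have e1 : 1 < tv 1.
  by rewrite tvE; apply: (tau_gt (F0 := [:: x])) => [q|]; rewrite ?inE; window.
have e2 : tv 2 = 1.
  by rewrite tvE; apply: (tau_eq (F0 := [:: x])) => [q|]; rewrite ?inE; window.
heap_order.
Qed.

(** * Raising keys in an arbitrary tree *)

Lemma ltn_nth_sorted ks i j : sorted ltn ks -> i < j -> j < size ks ->
  nth 0 ks i < nth 0 ks j.
Proof.
move=> s_ks lt_ij lt_j; apply: (sorted_ltn_nth ltn_trans) => //.
by rewrite inE (ltn_trans lt_ij).
Qed.

Lemma leq_nth_sorted ks i j : sorted ltn ks -> i <= j -> j < size ks ->
  nth 0 ks i <= nth 0 ks j.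
Proof.
rewrite leq_eqVlt => s_ks /orP[/eqP-> //|lt_ij lt_j].
exact/ltnW/ltn_nth_sorted.
Qed.

(** Windows are open intervals whose finite ends are path keys, so neighbouring windows overlap only
    strictly between two consecutive path keys. *)
Lemma in_window_nth ks i j : sorted ltn ks -> i < size ks -> j < size ks ->
  in_window ks j (nth 0 ks i) = (j == i).
Proof.
move=> s_ks lt_i lt_j; rewrite /in_window.
have [lt_ji|lt_ij|->] := ltngtP j i.
- rewrite (leq_ltn_trans lt_ji lt_i) ltnNge leq_nth_sorted // andbF //.
- case: j lt_j lt_ij => // j lt_j; rewrite ltnS => le_ij.
  by rewrite ltnNge leq_nth_sorted // ltnW.
- case: i lt_i {lt_j} => [|i] lt_i; last rewrite ltn_nth_sorted //=.
    by case: ifP => // ?; apply: ltn_nth_sorted.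
  by case: ifP => // ?; apply: ltn_nth_sorted.
Qed.

Lemma iota_split i n : i < n -> iota 0 n = iota 0 i ++ i :: iota i.+1 (n - i.+1).
Proof. by move=> lt_in; rewrite -{1}(subnKC lt_in) addSnnS iotaD. Qed.

Lemma build_treap_iota f key pr n rs i (g := fun j => (key j, pr j)) :
  i < n -> size rs = n.+1 -> (forall j, j < n -> j != i -> plt (pr i) (pr j)) ->
  build_treap f.+1 (map g (iota 0 n)) rs =
  Node (build_treap f (map g (iota 0 i)) (take i.+1 rs)) (key i)
       (build_treap f (map g (iota i.+1 (n - i.+1))) (drop i.+1 rs)).
Proof.
move=> lt_in sz top.
rewrite (iota_split lt_in) map_cat -{1}(cat_take_drop i.+1 rs) map_cons.
rewrite build_treap_top // => [|q].
  by rewrite size_takel ?sz 1?ltnW // size_map size_iota.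
rewrite -map_cat => /mapP[j]; rewrite mem_cat !mem_iota => jin ->.
by apply: top; lia.
Qed.

Lemma sorted_path_split x T d : sorted ltn (inorder T) ->
  sorted ltn (map fst (path_split x T d).1).
Proof. by apply: subseq_sorted; [exact: ltn_trans | exact: subseq_path_split]. Qed.

Lemma build_treap_nil f S : build_treap f [::] S = head Leaf S.
Proof. by case: f. Qed.

(** When [x] is repeated at once, it alone on the path has [tau] 0, by [in_window_nth]. *)
Lemma gf_step_to_root F T x : sorted ltn (inorder T) -> x \in inorder T ->
  exists A B, gf_step (x :: F) T x = Node A x B.
Proof.
move=> sT xT; rewrite gf_stepE.
have := sorted_path_split x 0 sT; have := mem_path_split 0 sT xT.
have := size_path_split x T 0; case: path_split => kd rs /= sz xin s_ks.
rewrite /items_of; set ks := map fst kd in xin s_ks *.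
have szk : size ks = size kd by rewrite size_map.
pose i := index x ks; have lt_i : i < size kd by rewrite -szk index_mem.
have nth_i : nth 0 ks i = x by rewrite nth_index.
have [f ef] : exists f, size kd = f.+1 by exists (size kd).-1; lia.
rewrite {1}ef (build_treap_iota _ _ lt_i) // ?nth_i; first by do 2 eexists.
move=> j lt_j ne_ji; apply: plt_lt.
rewrite tau_eq0; last by rewrite -nth_i in_window_nth ?szk ?eqxx.
by apply: tau_gt0; rewrite -nth_i in_window_nth ?szk.
Qed.

(** Here [y] has [tau] 0 and [x] has [tau] 1, all other path keys coming later. As the search goes
    right at [x], this is the smallest path key; it becomes the root of the left part and keeps [A]
    intact. *)
Lemma gf_step_lift F A x B y : sorted ltn (inorder (Node A x B)) ->
  y \in inorder (Node A x B) -> x < y ->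
  exists C D, gf_step (y :: x :: F) (Node A x B) y = Node (Node A x C) y D.
Proof.
move=> sT yT lt_xy; rewrite gf_stepE.
have := sorted_path_split y 0 sT; have := mem_path_split 0 sT yT.
have := size_path_split y (Node A x B) 0; rewrite path_split_gt //.
case: path_split => kd' rs'; cbn [fst snd]; set kd := (x, 0) :: kd'.
rewrite /items_of; set ks := map fst kd => sz yin s_ks.
pose i := index y ks; have szk : size ks = size kd by rewrite size_map.
have lt_i : i < size kd by rewrite -szk index_mem.
have nth_i : nth 0 ks i = y by rewrite nth_index.
have i_gt0 : 0 < i by rewrite /i /= ltn_eqF.
(* Two units of fuel expose the two top levels, [y] and below it [x]. *)
have [f ef] : exists f, size kd = f.+2.
  by exists (size kd).-2; move: lt_i i_gt0; lia.
rewrite {1}ef (build_treap_iota _ _ lt_i) ?nth_i //.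
  rewrite (build_treap_iota _ _ i_gt0) ?build_treap_nil; first by do 2 eexists.
    by rewrite size_takel ?sz // ltnW.
  move=> [|j] // lt_ji _; apply: plt_lt.
  have x0 : x = nth 0 ks 0 by [].
  rewrite [X in X < _](tau_eq (F0 := [:: y])) => [|u|].
  - apply: (tau_gt (F0 := [:: y])) => [u|].
      by rewrite inE => /eqP->; rewrite -nth_i in_window_nth ?szk //; lia.
    by rewrite x0 in_window_nth ?szk //; lia.
  - by rewrite inE => /eqP->; rewrite -nth_i in_window_nth ?szk //; lia.
  - by rewrite x0 in_window_nth ?szk.
move=> j lt_j ne_ji; apply: plt_lt.
rewrite tau_eq0; last by rewrite -nth_i in_window_nth ?szk ?eqxx.
by apply: tau_gt0; rewrite -nth_i in_window_nth ?szk.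
Qed.

(** * The two regimes *)

(* Cell j consists of the keys 5j + 1, ..., 5j + 5. *)
Definition key (c j : nat) := 5 * j + c.
Notation ka := (key 1).
Notation kr := (key 2).
Notation kb := (key 3).
Notation ks := (key 4).
Notation kt := (key 5).

Definition sweep_up (f : nat -> nat) i k := [seq f j | j <- iota i k].
Definition sweep_down (f : nat -> nat) k := [seq f j | j <- rev (iota 0 k)].

Lemma sweep_down_cat f i k :
  sweep_down f (i + k) = [seq f j | j <- rev (iota i k)] ++ sweep_down f i.
Proof. by rewrite /sweep_down iotaD rev_cat map_cat. Qed.

Lemma sweep_downS f k : sweep_down f k.+1 = f k :: sweep_down f k.
Proof. by rewrite -addn1 sweep_down_cat. Qed.

Lemma sweep_upS f i k : sweep_up f i k.+1 = f i :: sweep_up f i.+1 k.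
Proof. by []. Qed.

Lemma sweep_up_cat f i j k :
  sweep_up f i (j + k) = sweep_up f i j ++ sweep_up f (i + j) k.
Proof. by rewrite /sweep_up iotaD map_cat. Qed.

Lemma mem_sweep_up f i k (q : nat) : q \in sweep_up f i k ->
  exists2 j, i <= j < i + k & q = f j.
Proof. by case/mapP=> j; rewrite mem_iota => jP ->; exists j. Qed.

Lemma mem_rev_iota (f : nat -> nat) i k q :
  q \in [seq f j | j <- rev (iota i k)] ->
  exists2 j, i <= j < i + k & q = f j.
Proof. by case/mapP=> j; rewrite mem_rev mem_iota => jP ->; exists j. Qed.

Ltac keys := unfold key in *; lia.

(* The good regime, with the node b_j at the root: good_left j describes its left
   subtree (cells 0, ..., j, apart from b_j), good_right j.+1 k its right subtree
   (the next k cells).  The keys r_i, s_i, t_i sit in the subtrees P, Q. *)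
Fixpoint good_left j Z :=
  if j is j'.+1 then
    exists Z' P Q, Z = Node Z' (kb j') (Node P (ka j) Q) /\ good_left j' Z'
  else exists P Q, Z = Node P (ka 0) Q.

Fixpoint good_right i k W :=
  if k is k'.+1 then
    exists P Q W', W = Node (Node P (ka i) Q) (kb i) W' /\ good_right i.+1 k' W'
  else True.

(** Each access is a single rotation, which hands the subtree of a_j over from b_{j-1} to b_j and so
    moves cell j from the left side to the right side. *)
Lemma good_down j k Z W F : good_left j Z -> good_right j.+1 k W ->
  exists Z' W', [/\ good_left 0 Z', good_right 1 (j + k) W' &
    serves (ka 0 :: F) (Node Z (kb j) W) (sweep_down kb j)
      (Node Z' (kb 0) W') (2 * j)].
Proof.
elim: j k Z W => [|j IH] k Z W; first by exists Z, W; split=> //; constructor.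
case=> [Z1 [P [Q [-> gZ]]]] gW.
have gW1 : good_right j.+1 k.+1 (Node (Node P (ka j.+1) Q) (kb j.+1) W).
  by exists P, Q, W.
have [Z' [W' [gZ' gW' sv]]] := IH _ _ _ gZ gW1.
exists Z', W'; split=> //; first by rewrite addSnnS.
rewrite sweep_downS mulnS; apply: serves_step_to sv.
have [h [F' [-> le_h]]] : exists h F',
    sweep_down kb j ++ ka 0 :: F = h :: F' /\ h <= kb j.
  case: (j) => [|i]; first by exists (ka 0), F.
  rewrite sweep_downS; exists (kb i), (sweep_down kb i ++ ka 0 :: F).
  by split=> //; keys.
by apply: step_rotate_right; keys.
Qed.

Lemma good_up k i Z W F : good_left i Z -> good_right i.+1 k W ->
  exists Z' W', good_left (i + k) Z' /\
    serves (sweep_down kb (i + k).+1 ++ F) (Node Z (kb i) W) (sweep_up ka i.+1 k)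
      (Node Z' (kb (i + k)) W') (3 * k).
Proof.
elim: k i Z W => [|k IH] i Z W gZ.
  by exists Z, W; rewrite addn0; split=> //; constructor.
case=> [P [Q [W1 [-> gW]]]].
have gZ1 : good_left i.+1 (Node Z (kb i) (Node P (ka i.+1) Q)).
  by exists Z, P, Q.
have [Z' [W' [gZ' sv]]] := IH _ _ _ gZ1 gW.
exists Z', W'; rewrite -addSnnS; split=> //.
rewrite sweep_upS mulnS; apply: serves_step_to sv.
(* The coming downward sweep is cut at b_i, the first future query not above the current root
   b_i. *)
rewrite (_ : (i.+1 + k).+1 = i.+1 + k.+1); last by lia.
rewrite sweep_down_cat sweep_downS -!catA catA.
apply: step_good_up => //; first by keys.
  by rewrite size_cat !size_map size_rev !size_iota addnS.
by move=> q; rewrite mem_cat => /orP[/mem_sweep_up|/mem_rev_iota] [j jP ->]; keys.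
Qed.

Lemma good_period m Z R F : good_left m.+1 Z ->
  exists Z' R', good_left m.+1 Z' /\
    serves (sweep_down kb m.+2 ++ F) (Node Z (kb m.+1) R)
      (sweep_down kb m.+2 ++ sweep_up ka 0 m.+2) (Node Z' (kb m.+1) R')
      (5 * m + 8).
Proof.
move=> gZ.
have [Z1 [W1 [gZ1 gW1 sv1]]] := good_down (k := 0) (W := R)
  (sweep_up ka 1 m.+1 ++ sweep_down kb m.+2 ++ F) gZ I.
rewrite addn0 in gW1.
have [Z2 [W2 [gZ2 sv2]]] := good_up F gZ1 gW1.
exists Z2, W2; split; first by rewrite -[m.+1]add0n.
(* The turning accesses b_{m+1} and a_0 cost 1 and 2, the others 2 on the way down and 3 on the way
   up. *)
have -> : 5 * m + 8 = 1 + 2 * m.+1 + (2 + 3 * m.+1) by lia.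
have [P [Q eZ1]] := gZ1.
apply: (serves_cat (T1 := Node Z1 (kb 0) W1)).
  rewrite [X in serves _ _ X]sweep_downS.
  by apply: serves_step_to sv1; exact: step_root.
rewrite [X in serves _ _ X]sweep_upS; apply: serves_step_to sv2.
by rewrite eZ1 sweep_upS; apply: step_good_first; keys.
Qed.

(* The bad regime, analogously.  During the upward sweep some s_j is at the
   root, during the downward sweep some t_j. *)
Definition bad_cell i C :=
  exists P P' Q Q', C = Node (Node P (ka i) P') (kr i) (Node Q (kb i) Q').

Fixpoint bad_left j V :=
  if j is j'.+1 then
    exists V' X C, [/\ V = Node (Node V' (ks j') X) (kt j') C, bad_left j' V' &
                       bad_cell j C]
  else bad_cell 0 V.

Fixpoint bad_right i k D :=
  if k is k'.+1 then
    exists C X D', [/\ D = Node C (ks i) (Node X (kt i) D'), bad_cell i C &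
                       bad_right i.+1 k' D']
  else bad_cell i D.

Lemma bad_down j k V X D F : bad_left j V -> bad_right j.+1 k D ->
  exists2 T', bad_right 0 (j + k).+1 T' &
    serves (sweep_up kb 0 (j + k).+2 ++ F) (Node (Node V (ks j) X) (kt j) D)
      (sweep_down ka j.+1) T' (5 * j + 4).
Proof.
elim: j k V X D => [|j IH] k V X D.
  move=> cV bD.
  exists (Node V (ks 0) (Node X (kt 0) D)); first by exists V, X, D.
  have [P1 [P1' [Q1 [Q1' ->]]]] := cV.
  apply: (serves_step_to (c1 := 4) (c2 := 0)); last exact: ServesNil.
  rewrite sweep_upS; apply: step_bad_bottom; keys.
case=> [V1 [X1 [C [-> bV cC]]]] bD.
have bD1 : bad_right j.+1 k.+1 (Node C (ks j.+1) (Node X (kt j.+1) D)).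
  by exists C, X, D.
have [T' bT' sv] := IH _ _ X1 _ bV bD1; exists T'; first by rewrite addSnnS.
rewrite addSnnS sweep_downS (_ : 5 * j.+1 + 4 = 5 + (5 * j + 4)); last by lia.
apply: serves_step_to sv; have [P [P' [Q [Q' ->]]]] := cC.
(* The first future query above t_j is b_{j+1}, which lies between r_{j+1} and s_{j+1} and causes
   the tie. *)
rewrite (_ : (j + k.+1).+2 = j.+1 + k.+2); last by lia.
rewrite sweep_up_cat [sweep_up kb (0 + _) _]sweep_upS -catA catA.
apply: step_bad_down; try keys.
- by rewrite sweep_downS.
move=> q; rewrite mem_cat => /orP[/mem_rev_iota|/mem_sweep_up] [i iP ->]; keys.
Qed.

Lemma bad_up k j V X D F : bad_left j V -> bad_right j.+1 k D ->
  exists V' X' E, [/\ bad_left (j + k) V', bad_cell (j + k).+1 E &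
    serves (sweep_down ka (j + k).+2 ++ F) (Node V (ks j) (Node X (kt j) D))
      (sweep_up kb j.+1 k.+1) (Node (Node V' (ks (j + k)) X') (kt (j + k)) E)
      (5 * k + 4)].
Proof.
elim: k j V X D => [|k IH] j V X D bV.
  move=> cD; exists V, X, D; rewrite addn0; split=> //.
  rewrite sweep_upS.
  apply: (serves_step_to (c1 := 4) (c2 := 0)); last exact: ServesNil.
  have [P [P' [Q [Q' ->]]]] := cD; rewrite /= sweep_downS.
  by apply: step_bad_last; keys.
case=> [C [X1 [D1 [-> cC bD]]]].
have bV1 : bad_left j.+1 (Node (Node V (ks j) X) (kt j) C) by exists V, X, C.
have [V' [X' [E [bV' cE sv]]]] := IH _ _ X1 _ bV1 bD.
exists V', X', E; rewrite -addSnnS; split=> //.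
rewrite sweep_upS (_ : 5 * k.+1 + 4 = 5 + (5 * k + 4)); last by lia.
apply: serves_step_to sv; have [P [P' [Q [Q' ->]]]] := cC.
(* The first future query below s_{j+1} is a_{j+1}, which lies between t_j and r_{j+1}. *)
rewrite (_ : (j.+1 + k).+2 = j.+2 + k.+1); last by lia.
rewrite sweep_down_cat sweep_downS -!catA catA; apply: step_bad_up; try keys.
  by rewrite size_cat size_map size_iota.
by move=> q; rewrite mem_cat => /orP[/mem_sweep_up|/mem_rev_iota] [i iP ->]; keys.
Qed.

Lemma bad_period m V X E F : bad_left m V -> bad_cell m.+1 E ->
  exists V' X' E', [/\ bad_left m V', bad_cell m.+1 E' &
    serves (sweep_down ka m.+2 ++ F) (Node (Node V (ks m) X) (kt m) E)
      (sweep_down ka m.+2 ++ sweep_up kb 0 m.+2)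
      (Node (Node V' (ks m) X') (kt m) E')
      (10 * m + 14)].
Proof.
move=> bV cE.
have [T1 bT1 sv1] := bad_down X (sweep_down ka m.+2 ++ F) bV
  (cE : bad_right m.+1 0 E).
rewrite addn0 in bT1 sv1; have [C [X1 [D1 [eT1 cC bD1]]]] := bT1.
have [V' [X' [E' [bV' cE' sv2]]]] := bad_up X1 F (cC : bad_left 0 C) bD1.
exists V', X', E'; split=> //.
(* Each sweep has a first access of cost 3, then m accesses of cost 5 and a last one of cost 4. *)
have -> : 10 * m + 14 = 3 + (5 * m + 4) + (3 + (5 * m + 4)) by lia.
apply: (serves_cat (T1 := T1)).
  rewrite [X in serves _ _ X]sweep_downS; apply: serves_step_to sv1.
  have [P [P' [Q [Q' ->]]]] := cE.
  rewrite -[X in sweep_up kb 0 X]addn1 sweep_up_cat.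
  rewrite [sweep_up kb (0 + _) _]sweep_upS -!catA catA.
  apply: step_bad_top; try keys.
    by rewrite sweep_downS.
  by move=> q; rewrite mem_cat => /orP[/mem_rev_iota|/mem_sweep_up] [i iP ->]; keys.
rewrite eT1 [X in serves _ _ X]sweep_upS; apply: serves_step_to sv2.
have [P [P' [Q [Q' ->]]]] := cC.
rewrite -[X in sweep_down ka X](addn1 m.+1) addnC sweep_down_cat sweep_downS.
rewrite -!catA catA.
apply: step_bad_first; try keys.
  by rewrite size_cat size_map size_iota.
by move=> q; rewrite mem_cat => /orP[/mem_sweep_up|/mem_rev_iota] [i iP ->]; keys.
Qed.

(** * Forcing a regime from an arbitrary tree *)

(** The cost of a forcing prefix is forgotten: the crude bound [serves_cost_le] suffices, as it does
    not grow with the number of periods. *)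
Definition reach F T X T' := exists c, serves F T X T' c.

Lemma reach_nil F T : reach F T [::] T.
Proof. by exists 0; constructor. Qed.

Lemma reach_step F T x X T1 T2 c : step_to (X ++ F) T x T1 c ->
  reach F T1 X T2 -> reach F T (x :: X) T2.
Proof. by move=> st [c2 sv]; exists (c + c2); apply: serves_step_to sv. Qed.

Lemma reach_cat F T X Y T1 T2 : reach (Y ++ F) T X T1 -> reach F T1 Y T2 ->
  reach F T (X ++ Y) T2.
Proof. by move=> [c1 s1] [c2 s2]; exists (c1 + c2); apply: serves_cat s2. Qed.

Lemma reach_bst n F T X T' : reach F T X T' -> is_bst_on n T -> is_bst_on n T'.
Proof. by case=> c /serves_inorder; rewrite /is_bst_on => ->. Qed.

Lemma bst_sorted n T : is_bst_on n T -> sorted ltn (inorder T).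
Proof. by move=> ->; exact: iota_ltn_sorted. Qed.

Lemma mem_bst n T x : is_bst_on n T -> 0 < x <= n -> x \in inorder T.
Proof. by move=> ->; rewrite mem_iota; lia. Qed.

Lemma reach_root n F T x : is_bst_on n T -> 0 < x <= n ->
  exists A B, reach F T [:: x; x] (Node A x B).
Proof.
move=> bT xP.
have [A [B e]] := gf_step_to_root F (bst_sorted bT) (mem_bst bT xP).
exists A, B; apply: (reach_step (T1 := Node A x B)) => //.
by apply: (reach_step (T1 := Node A x B)); [exact: step_root | exact: reach_nil].
Qed.

Definition lift_word (x y : nat) := [:: y; y; x; x; y; y].

(* Doubling each access makes the outcome independent of the later future F: the
   accessed key goes to the root, and the next key accessed comes right below. *)
Lemma reach_lift n F A x B y : is_bst_on n (Node A x B) -> x < y <= n ->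
  exists C D, reach F (Node A x B) (lift_word x y) (Node (Node A x C) y D).
Proof.
move=> bT yP; have [lt_xy le_yn] := andP yP.
have yT : y \in inorder (Node A x B) by apply: (mem_bst bT); lia.
have [C [D e]] := gf_step_lift (x :: y :: y :: F) (bst_sorted bT) yT lt_xy.
exists C, D.
apply: (reach_step (T1 := Node (Node A x C) y D)) => //.
apply: reach_step; first exact: step_root.
apply: reach_step; first by apply: step_rotate_right => //; exact: leqnn.
apply: reach_step; first exact: step_root.
apply: reach_step; first by apply: step_rotate_left => //; exact: leqnn.
by apply: reach_step; [exact: step_root | exact: reach_nil].
Qed.

Definition nest_word (x y z : nat) :=
  lift_word x y ++ lift_word y z ++ [:: x; x; z; z].

Lemma reach_nest n F Z x D y z : is_bst_on n (Node Z x D) -> x < y < z -> z <= n ->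
  exists C C' D', reach F (Node Z x D) (nest_word x y z)
    (Node (Node Z x (Node C y C')) z D').
Proof.
move=> bT lt le_zn.
have [|C [D1 r1]] :=
    reach_lift (lift_word y z ++ [:: x; x; z; z] ++ F) bT (y := y).
  by lia.
have [|C' [D2 r2]] := reach_lift ([:: x; x; z; z] ++ F) (reach_bst r1 bT) (y := z).
  by lia.
exists C, C', D2; apply: reach_cat; first by rewrite -catA; exact: r1.
apply: reach_cat r2 _.
apply: reach_step; first exact: step_unnest.
apply: reach_step; first exact: step_root.
apply: reach_step; first by apply: step_rotate_left; [lia | exact: leqnn].
by apply: reach_step; [exact: step_root | exact: reach_nil].
Qed.

Lemma iota_infix i n A B C : iota i n = A ++ B ++ C ->
  B = iota (i + size A) (size B).
Proof.
move=> e; have en : n = size A + (size B + size C).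
  by rewrite -!size_cat -e size_iota.
rewrite en !iotaD in e.
have /eqP := e; rewrite eqseq_cat ?size_iota // => /andP[_].
by rewrite eqseq_cat ?size_iota // => /andP[/eqP].
Qed.

Lemma iota_gap i n A x B C : iota i n = A ++ x :: B ++ x.+2 :: C -> B = [:: x.+1].
Proof.
have -> : x :: B ++ x.+2 :: C = (x :: rcons B x.+2) ++ C by rewrite /= cat_rcons.
move=> /iota_infix /= [-> e]; move: e.
rewrite size_rcons -[(size B).+1]addn1 iotaD cats1.
by move=> /rcons_inj[eB e1]; rewrite eB (_ : size B = 1) //; lia.
Qed.

Lemma inorder1 T a : inorder T = [:: a] -> T = Node Leaf a Leaf.
Proof.
case: T => [|[|l k l'] x r] //=; last first.
  by move/(congr1 size); rewrite /= !size_cat /= !addnS.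
by case: r => [|rl rk rr] /= [->] // /(congr1 size); rewrite size_cat /= addnS.
Qed.

(** Locates keys that [bad_prefix] never accesses, such as a_j and b_j: a subtree enclosed between
    two keys at distance two can only be one node. *)
Lemma bst_gap n T A x a y G C : is_bst_on n T ->
  inorder T = A ++ x :: inorder G ++ y :: C -> a = x.+1 -> y = x.+2 ->
  G = Node Leaf a Leaf.
Proof. by move=> -> e -> ey; rewrite ey in e; exact/inorder1/iota_gap/e. Qed.

Fixpoint good_prefix j :=
  if j is j'.+1 then
    good_prefix j' ++ nest_word (kb j') (ka j) (kb j)
  else [:: ka 0; ka 0] ++ lift_word (ka 0) (kb 0).

Lemma good_prefix_reach n j F T : is_bst_on n T -> kb j <= n ->
  exists Z R, good_left j Z /\ reach F T (good_prefix j) (Node Z (kb j) R).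
Proof.
move=> bT; elim: j F => [|j IH] F le_n.
  have [|A [B r1]] := reach_root (lift_word (ka 0) (kb 0) ++ F) bT (x := ka 0).
    by keys.
  have [|C [D r2]] := reach_lift F (reach_bst r1 bT) (y := kb 0); first by keys.
  by exists (Node A (ka 0) C), D; split; [exists A, C | exact: reach_cat r2].
have [|Z [R [gZ r1]]] := IH (nest_word (kb j) (ka j.+1) (kb j.+1) ++ F).
  by keys.
have [||C [C' [D r2]]] :=
  reach_nest F (reach_bst r1 bT) (y := ka j.+1) (z := kb j.+1).
- by keys.
- by [].
exists (Node Z (kb j) (Node C (ka j.+1) C')), D.
by split; [exists Z, C, C' | exact: reach_cat r2].
Qed.

Fixpoint bad_prefix j :=
  if j is j'.+1 then
    bad_prefix j' ++ lift_word (ks j') (kt j') ++ nest_word (kt j') (kr j) (ks j)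
  else [:: kr 0; kr 0] ++ lift_word (kr 0) (ks 0).

Lemma bad_prefix_reach n j F T : is_bst_on n T -> ks j <= n ->
  exists V D, bad_left j V /\ reach F T (bad_prefix j) (Node V (ks j) D).
Proof.
move=> bT; elim: j F => [|j IH] F le_n.
  have [|A [B r1]] := reach_root (lift_word (kr 0) (ks 0) ++ F) bT (x := kr 0).
    by keys.
  have [|C [D r2]] := reach_lift F (reach_bst r1 bT) (y := ks 0); first by keys.
  have bT2 := reach_bst r2 (reach_bst r1 bT).
  have eA : A = Node Leaf (ka 0) Leaf.
    (* The leftmost cell has no key before a_0 = 1, so a fictitious key 0 is put in front. *)
    apply/inorder1/(@iota_gap 0 n.+1 [::] 0 _ (inorder C ++ ks 0 :: inorder D)).
    by rewrite /= -bT2 /= -catA.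
  have eC : C = Node Leaf (kb 0) Leaf.
    apply: (@bst_gap n _ (inorder A) (kr 0) _ (ks 0) C (inorder D) bT2) => //.
    by rewrite /= -catA.
  exists (Node A (kr 0) C), D; split; last exact: reach_cat r2.
  by exists Leaf, Leaf, Leaf, Leaf; rewrite eA eC.
pose W := nest_word (kt j) (kr j.+1) (ks j.+1).
have [|V [D [bV r1]]] := IH (lift_word (ks j) (kt j) ++ W ++ F).
  by keys.
have [|X [D1 r2]] := reach_lift (W ++ F) (reach_bst r1 bT) (y := kt j).
  by keys.
have bT2 := reach_bst r2 (reach_bst r1 bT).
have [||C [C' [D2 r3]]] := reach_nest F bT2 (y := kr j.+1) (z := ks j.+1).
- by keys.
- by [].
have bT3 := reach_bst r3 bT2.
exists (Node (Node V (ks j) X) (kt j) (Node C (kr j.+1) C')), D2; split; last first.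
  by apply: reach_cat; [rewrite -catA; exact: r1 | exact: reach_cat r3].
exists V, X, (Node C (kr j.+1) C'); split=> //.
have -> : C = Node Leaf (ka j.+1) Leaf.
  apply: (@bst_gap n _ (inorder V ++ ks j :: inorder X) (kt j) _ (kr j.+1) C
    (inorder C' ++ ks j.+1 :: inorder D2) bT3); [| keys | keys].
  by rewrite /= -!catA /= -!catA.
have -> : C' = Node Leaf (kb j.+1) Leaf.
  apply: (@bst_gap n _ ((inorder V ++ ks j :: inorder X) ++ kt j :: inorder C)
    (kr j.+1) _ (ks j.+1) C' (inorder D2) bT3); [| keys | keys].
  by rewrite /= -!catA /= -!catA.
by exists Leaf, Leaf, Leaf, Leaf.
Qed.

(** The last cell gets no s_{m+1} above it that would isolate b_{m+1}, so b_{m+1} is lifted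
    explicitly. The final accesses to r_{m+1} and t_m rotate the chain back until t_m is the
    root. *)
Definition bad_start m :=
  bad_prefix m ++ lift_word (ks m) (kt m) ++ lift_word (kt m) (kr m.+1) ++
  lift_word (kr m.+1) (kb m.+1) ++ [:: kr m.+1; kr m.+1; kt m; kt m].

Lemma bad_start_reach n m F T : is_bst_on n T -> kb m.+1 <= n ->
  exists V X E, [/\ bad_left m V, bad_cell m.+1 E &
    reach F T (bad_start m) (Node (Node V (ks m) X) (kt m) E)].
Proof.
move=> bT le_n; set W4 := [:: kr m.+1; kr m.+1; kt m; kt m].
set W3 := lift_word (kr m.+1) (kb m.+1) ++ W4.
set W2 := lift_word (kt m) (kr m.+1) ++ W3.
have [|V [D [bV r1]]] :=
    @bad_prefix_reach n m ((lift_word (ks m) (kt m) ++ W2) ++ F) T bT.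
  by keys.
have bT1 := reach_bst r1 bT.
have [|X [D1 r2]] := reach_lift (W2 ++ F) bT1 (y := kt m); first by keys.
have bT2 := reach_bst r2 bT1.
have [|C [D2 r3]] := reach_lift (W3 ++ F) bT2 (y := kr m.+1); first by keys.
have bT3 := reach_bst r3 bT2.
have [|C' [D3 r4]] := reach_lift (W4 ++ F) bT3 (y := kb m.+1); first by keys.
exists V, X, (Node C (kr m.+1) (Node C' (kb m.+1) D3)); split=> //.
  have -> : C = Node Leaf (ka m.+1) Leaf.
    apply: (@bst_gap n _ (inorder V ++ ks m :: inorder X) (kt m) _ (kr m.+1) C
      (inorder D2) bT3); [| keys | keys].
    by rewrite /= -!catA.
  by exists Leaf, Leaf, C', D3.
apply: reach_cat r1 _; apply: reach_cat r2 _; apply: reach_cat r3 _.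
apply: reach_cat r4 _.
apply: reach_step; first by apply: step_rotate_right; [keys | exact: leqnn].
apply: reach_step; first exact: step_root.
apply: reach_step; first by apply: step_rotate_right; [keys | exact: leqnn].
by apply: reach_step; [exact: step_root | exact: reach_nil].
Qed.

(** * Costs *)

Definition good_word m := sweep_down kb m.+2 ++ sweep_up ka 0 m.+2.
Definition bad_word m := sweep_down ka m.+2 ++ sweep_up kb 0 m.+2.

Lemma rev_good_word m : rev (good_word m) = bad_word m.
Proof. by rewrite rev_cat /good_word /sweep_up /sweep_down -!map_rev revK. Qed.

Lemma rev_flatten_nseq M (w : seq nat) :
  rev (flatten (nseq M w)) = flatten (nseq M (rev w)).
Proof. by rewrite rev_flatten map_nseq rev_nseq. Qed.

(** [good_period] requires another downward sweep to follow, so the last of the [M.+1] copies is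
    bounded trivially together with [B]. In [bad_cost_ge] the last copy is simply dropped. *)
Lemma good_cost_le n m M Z R B : good_left m.+1 Z ->
  is_bst_on n (Node Z (kb m.+1) R) ->
  gf_cost (Node Z (kb m.+1) R) (flatten (nseq M.+1 (good_word m)) ++ B) <=
  M * (5 * m + 8) + (size (good_word m) + size B) * n.
Proof.
elim: M Z R => [|M IH] Z R gZ bT.
  rewrite /= cats0 mul0n add0n (leq_trans (gf_cost_le _ _)) //.
  by rewrite size_cat bT size_iota.
have [Z' [R' [gZ' sv]]] := good_period R
  (sweep_up ka 0 m.+2 ++ flatten (nseq M (good_word m)) ++ B) gZ.
have bT' : is_bst_on n (Node Z' (kb m.+1) R').
  by rewrite /is_bst_on (serves_inorder sv).
have := IH _ _ gZ' bT'.
have -> : flatten (nseq M.+2 (good_word m)) ++ B =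
  good_word m ++ (flatten (nseq M.+1 (good_word m)) ++ B) by rewrite /= -!catA.
have := serves_cost sv; rewrite (catA (sweep_down kb m.+2)) -/(good_word m).
rewrite [nseq M.+1 _]/=.
rewrite [flatten (_ :: _)]/= -catA => -> le_M.
by rewrite [M.+1 * _]mulSn -[X in _ <= X]addnA leq_add2l.
Qed.

Lemma bad_cost_ge m M V X E B : bad_left m V -> bad_cell m.+1 E ->
  M * (10 * m + 14) <=
  gf_cost (Node (Node V (ks m) X) (kt m) E)
    (flatten (nseq M.+1 (bad_word m)) ++ B).
Proof.
elim: M V X E => [|M IH] V X E bV cE //.
have [V' [X' [E' [bV' cE' sv]]]] := bad_period X
  (sweep_up kb 0 m.+2 ++ flatten (nseq M (bad_word m)) ++ B) bV cE.
have := IH _ X' _ bV' cE'.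
have -> : flatten (nseq M.+2 (bad_word m)) ++ B =
  bad_word m ++ (flatten (nseq M.+1 (bad_word m)) ++ B) by rewrite /= -!catA.
have := serves_cost sv; rewrite (catA (sweep_down ka m.+2)) -/(bad_word m).
rewrite [nseq M.+1 _]/=.
rewrite [flatten (_ :: _)]/= -catA => -> le_M.
by rewrite [M.+1 * _]mulSn leq_add2l.
Qed.

(** * Key range and final estimate *)

Definition in_range n x := 1 <= x <= n.

Lemma all_key_seq n c (s : seq nat) k : 1 <= c <= 5 -> 5 * k <= n ->
  all (fun j => j < k) s -> all (in_range n) [seq key c j | j <- s].
Proof.
move=> cP kP /allP sP; rewrite all_map; apply/allP=> j /sP jP /=.
rewrite /in_range /key; lia.
Qed.

Lemma all_good_word n m : 5 * m.+2 <= n -> all (in_range n) (good_word m).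
Proof.
move=> le_n; rewrite all_cat /sweep_down /sweep_up.
rewrite !(@all_key_seq n _ _ m.+2) //; apply/allP=> j.
  by rewrite mem_iota.
by rewrite mem_rev mem_iota.
Qed.

Lemma all_good_prefix n j : 5 * j.+1 <= n -> all (in_range n) (good_prefix j).
Proof.
elim: j => [|j IH] le_n; first by rewrite /= /in_range /key; lia.
rewrite /= all_cat IH /=; last by lia.
by rewrite /in_range /key; lia.
Qed.

Lemma all_bad_prefix n j : 5 * j.+1 <= n -> all (in_range n) (bad_prefix j).
Proof.
elim: j => [|j IH] le_n; first by rewrite /= /in_range /key; lia.
rewrite /= all_cat IH /=; last by lia.
by rewrite /in_range /key; lia.
Qed.

Lemma all_bad_start n m : 5 * m.+2 <= n -> all (in_range n) (bad_start m).
Proof.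
move=> le_n; rewrite all_cat all_bad_prefix /=; last by lia.
by rewrite /in_range /key; lia.
Qed.

Lemma gf_cost_bounds n m T0 : 5 * m.+2 <= n -> is_bst_on n T0 ->
  exists C, forall M, exists2 X, query_seq_on n X & [/\ 0 < size X,
    gf_cost T0 X <= M * (5 * m + 8) + C &
    M * (10 * m + 14) <= gf_cost T0 (rev X)].
Proof.
(* Reversing [B] makes [rev X] begin with [bad_start m]. *)
move=> le_n bT; pose A := good_prefix m.+1; pose B := rev (bad_start m).
(* The overhead covers the prefix, the last copy of the word and the tail, at most [n] per access,
   uniformly in [M]. *)
exists ((size A + (size (good_word m) + size B)) * n) => M.
pose P := flatten (nseq M.+1 (good_word m)).
exists (A ++ P ++ B).
  rewrite /query_seq_on -/(in_range n) -[all _ _]/(all (in_range n) _).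
  rewrite 2!all_cat all_good_prefix // all_rev all_bad_start // andbT andTb.
  rewrite /P; elim: M.+1 => // k IH.
  by rewrite /= all_cat all_good_word.
split.
- have : 0 < size P by rewrite /P /= /good_word sweep_downS.
  by rewrite !size_cat; lia.
- have [|Z [R [gZ [c sv]]]] := @good_prefix_reach n m.+1 (P ++ B) T0 bT.
    by keys.
  have bT' : is_bst_on n (Node Z (kb m.+1) R).
    by rewrite /is_bst_on (serves_inorder sv).
  rewrite (serves_cost sv) mulnDl addnCA; apply: leq_add.
    by have := serves_cost_le sv; rewrite bT size_iota.
  exact: good_cost_le.
rewrite rev_cat rev_cat revK rev_flatten_nseq rev_good_word -catA.
have [|V [X [E [bV cE [c sv]]]]] := @bad_start_reach n m
  (flatten (nseq M.+1 (bad_word m)) ++ rev A) T0 bT; first by keys.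
rewrite (serves_cost sv) (leq_trans _ (leq_addl _ _)) //.
exact: bad_cost_ge.
Qed.

Theorem theorem4 :
  forall eps : R, (0 < eps)%R ->
  exists N : nat, forall n : nat, (N <= n)%N ->
  forall T0 : tree, is_bst_on n T0 ->
  exists X : seq nat,
    query_seq_on n X /\ (0 < size X)%N /\
    (INR (gf_cost T0 (rev X)) >= (2 - eps) * INR (gf_cost T0 X))%R.
Proof.
move=> eps eps_gt0.
(* Per period, 10m + 14 exceeds (2 - eps)(5m + 8) by eps(5m + 8) - 2, which this choice makes at
   least 1. *)
have [m m_eps] : exists m, (3 <= eps * INR m)%R.
  have [m mP] := INR_unbounded (3 / eps); exists m.
  have : (eps * (3 / eps) = 3)%R by field; lra.
  by nra.
exists (5 * m.+2) => n le_n T0 bT.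
have [C CP] := gf_cost_bounds le_n bT.
(* The gain of at least [M] over all periods then absorbs (2 - eps)C. *)
have [M MP] := INR_unbounded (2 * INR C).
have [X X_range [X_gt0 fwd bwd]] := CP M; exists X; split=> //; split=> //.
move: (gf_cost T0 X) (gf_cost T0 (rev X)) fwd bwd => x y.
move=> /leP/le_INR + /leP/le_INR.
rewrite -!multE -!plusE !(plus_INR, mult_INR).
have [-> -> -> ->] : [/\ INR 5 = 5, INR 8 = 8, INR 10 = 10 & INR 14 = 14]%R.
  by split; rewrite INR_IZR_INZ.
have := pos_INR x; have := pos_INR y; have := pos_INR M; have := pos_INR m.
have := pos_INR C.
move: (INR x) (INR y) (INR M) (INR m) (INR C) MP m_eps => {}x {}y u v c.
move=> uc ev c0 v0 u0 y0 x0 xle yge.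
(* For eps at least 2 the right-hand side is not positive; otherwise multiplying by 2 - eps
   preserves the upper bound. *)
have [eps_ge2|eps_lt2] := Rle_or_lt 2 eps; first by nra.
have h1 : ((2 - eps) * x <= (2 - eps) * (u * (5 * v + 8) + c))%R.
  by apply: Rmult_le_compat_l; lra.
have h2 : (u * 1 <= u * (eps * (5 * v + 8) - 2))%R.
  by apply: Rmult_le_compat_l; nra.
nra.
Qed.
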